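(* Let $Y$ be a skew-symmetric matrix. Let $l,m,n$ be nonnegative integers with the same parity, and let $I=(i_1,\dots,i_l)$, $J=(j_1,\dots,j_m)$ and $K=(k_1,\dots,k_n)$ be sequences of row/column indices of $Y$ of length $l$, $m$, $n$ respectively. Define an $(l+m)\times(l+m)$ skew-symmetric matrix $\widetilde{Y}=(\widetilde{y}_{\alpha,\beta})_{1\le\alpha,\beta\le l+m}$ by $$\widetilde{y}_{\alpha,\beta}=\operatorname{Pf}Y\bigl((i_\alpha,i_\beta)\sqcup J\sqcup K\bigr)\quad(1\le\alpha<\beta\le l),$$ $$\widetilde{y}_{\alpha,l+\beta}=\operatorname{Pf}Y\bigl((i_\alpha)\sqcup(J\setminus(j_\beta))\sqcup K\bigr)\quad(1\le\alpha\le l,\ 1\le\beta\le m),$$ $$\widetilde{y}_{l+\alpha,l+\beta}=\operatorname{Pf}Y\bigl((J\setminus(j_\alpha,j_\beta))\sqcup K\bigr)\quad(1\le\alpha<\beta\le m).$$ Then $$\operatorname{Pf}\widetilde{Y}=\operatorname{Pf}Y(I\sqcup K)\cdot\bigl(\operatorname{Pf}Y(J\sqcup K)\bigr)^{(l+m)/2-1}.$$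
   Context: Matrices have entries in a commutative ring; skew-symmetric means $y_{j,i}=-y_{i,j}$ and $y_{i,i}=0$. For a skew-symmetric matrix $Y=(y_{i,j})$ and a sequence $I=(i_1,\dots,i_a)$ of row/column indices, $Y(I)$ denotes the $a\times a$ skew-symmetric matrix $(y_{i_\alpha,i_\beta})_{1\le\alpha,\beta\le a}$. For sequences $I,J$, $I\sqcup J$ denotes their concatenation ($I$ followed by $J$). $J\setminus(j_\beta)$ (resp. $J\setminus(j_\alpha,j_\beta)$) denotes the sequence obtained from $J$ by removing the $\beta$-th entry (resp. the $\alpha$-th and $\beta$-th entries), keeping the order of the others. The Pfaffian of a $2N\times 2N$ skew-symmetric matrix $A=(a_{ij})$ is $$\operatorname{Pf}A=\sum_{\pi\in F_{2N}}\operatorname{sgn}(\pi)\,a_{\pi(1),\pi(2)}a_{\pi(3),\pi(4)}\cdots a_{\pi(2N-1),\pi(2N)},$$ where $F_{2N}$ is the set of permutations $\pi\in S_{2N}$ with $\pi(1)<\pi(3)<\dots<\pi(2N-1)$ and $\pi(2i-1)<\pi(2i)$ for $1\le i\le N$; the Pfaffian of the $0\times0$ matrix is $1$. In the degenerate case $l=m=0$ the exponent is $-1$, and the identity is understood only when the Pfaffian being inverted is invertible. *)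

(* Defs.v *)
From mathcomp Require Import all_boot all_order all_algebra all_fingroup.

Set Implicit Arguments.
Unset Strict Implicit.
Unset Printing Implicit Defensive.

Import GRing.Theory.
Local Open Scope ring_scope.

Definition skew_symmetric (R : comPzRingType) (n : nat) (A : 'M[R]_n) : Prop :=
  (forall i j, A j i = - A i j) /\ (forall i, A i i = 0).

(* F_n in 0-based indexing: s 0 < s 2 < s 4 < ... and s i < s (i + 1) for every
   even i. *)
Definition pf_perm (n : nat) (s : 'S_n) : bool :=
  [forall i : 'I_n, forall j : 'I_n,
     ~~ odd i && ((j == i.+1 :> nat) || (j == i.+2 :> nat)) ==> (s i < s j)%N].

(* Only meaningful for even n; it is stated for every n so that sizes such as
   size (I ++ K) need no cast to the form 2 * N. *)
Definition Pf (R : comPzRingType) (n : nat) (A : 'M[R]_n) : R :=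
  \sum_(s : 'S_n | pf_perm s)
     (-1) ^+ s *
     \prod_(p : 'I_n * 'I_n | ~~ odd p.1 && (p.2 == p.1.+1 :> nat))
        A (s p.1) (s p.2).

(* Y(I) for a sequence of indices I, with repetitions allowed. *)
Definition submx_seq (R : comPzRingType) (N : nat) (Y : 'M[R]_N)
    (I : seq 'I_N) : 'M[R]_(size I) :=
  \matrix_(a, b) Y (tnth (in_tuple I) a) (tnth (in_tuple I) b).

(* Removal of the entries of s whose (0-based) positions are listed in B. *)
Definition del_pos (T : Type) (B : seq nat) (s : seq T) : seq T :=
  mask [seq k \notin B | k <- iota 0 (size s)] s.

(* The skew-symmetric matrix with entry f i j at (i, j) for i < j. *)
Definition skew_mx (R : comPzRingType) (n : nat) (f : 'I_n -> 'I_n -> R) :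
    'M[R]_n :=
  \matrix_(i, j) if (i < j)%N then f i j else if (j < i)%N then - f j i else 0.

Definition Ytilde (R : comPzRingType) (N : nat) (Y : 'M[R]_N) (l m n : nat)
    (I : l.-tuple 'I_N) (J : m.-tuple 'I_N) (K : n.-tuple 'I_N) :
    'M[R]_(l + m) :=
  let B := \matrix_(a < l, b < m)
    Pf (submx_seq Y ([:: tnth I a] ++ del_pos [:: val b] J ++ K)) in
  block_mx
    (skew_mx (fun a b : 'I_l =>
       Pf (submx_seq Y ([:: tnth I a; tnth I b] ++ J ++ K))))
    B
    (- B^T)
    (skew_mx (fun a b : 'I_m =>
       Pf (submx_seq Y (del_pos [:: val a; val b] J ++ K)))).

(* Main.v *)
Require Import Defs.
From mathcomp Require Import all_boot all_order all_algebra all_fingroup.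
From mathcomp Require Import ring.

Set Implicit Arguments.
Unset Strict Implicit.
Unset Printing Implicit Defensive.

Import GRing.Theory.
Local Open Scope ring_scope.

(** The argument is about Pfaffians of words: for a form g on a set of letters,
    the Pfaffian of a word w is the Pfaffian of the matrix of the g x y, for x
    and y running through w.  Words can be concatenated, and their letters may
    be taken from an artificially enlarged alphabet.

    The engine is the signed contraction of a word by a function f of the
    letters, which sums (-1)^k f(w_k) F(w minus w_k) over the positions k.
    Expansion along the first row says that the Pfaffian of x :: w is the
    contraction of w by g x.  Contractions anticommute, as interior products in
    an exterior algebra do, and this makes the Pfaffian alternating in the
    letters.  Contractions over two different words commute, and this is
    exactly the Plücker relation [pf_plucker]

      sum_i +- Pf(u minus u_i) Pf(u_i v) = - sum_j +- Pf(v minus v_j) Pf(v_j u).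

    Taking u = x W and v = X W, where a repeated letter kills most terms, leaves

      Pf(W) Pf(x X W) = sum_k +- Pf(x X_k W) Pf((X minus X_k) W),

    which, up to powers of Pf(W), is the first row expansion of the Pfaffian
    of the matrix of the Pf(a b W), for a and b in X.  Induction gives
    [pf_wick]: that Pfaffian is Pf(X W) Pf(W)^h when X has 2h + 2 letters.  No
    division occurs, so the ring may be any commutative ring.

    This is the theorem when J is not touched.  Removals from J are reduced to
    it by adding to the alphabet, for every position s of J, a letter s* that
    is orthogonal to everything except the letter of J at position s.  A word
    containing s* has, up to sign, the Pfaffian of the word from which s* and
    its partner are deleted ([pf_partner]); choosing the value of the form on
    that pair to be (-1)^s absorbs all signs ([pf_star]).  With W = J K and
    X = I 0* 1* ... (m-1)*, the entries of the matrix of the theorem are the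
    Pf(a b W), while Pf(X W) collapses to the Pfaffian of I K.

    The remaining ingredient is the first row expansion of the Pfaffian defined
    by a sum over permutations ([Pf_expand]), which identifies it with the
    Pfaffian of words ([Pf_word]). *)

(** * Signed contractions of words *)

(** The letter z is removed first; passing to the rest of the word keeps z in
    front, which is why the recursive call changes F and the sign flips.  With
    this recursion, identities between contractions are proved by induction on
    the word with F generalized, without any manipulation of positions. *)
Fixpoint contract (R : comPzRingType) (T : Type) (f : T -> R)
    (F : seq T -> R) (w : seq T) : R :=
  if w is z :: v then f z * F v - contract f (fun v' => F (z :: v')) v else 0.

Lemma eq_contract (R : comPzRingType) (T : eqType) (f f' : T -> R)
    (F F' : seq T -> R) (w : seq T) :
  {in w, f =1 f'} -> (forall v, (size v).+1 = size w -> F v = F' v) ->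
  contract f F w = contract f' F' w.
Proof.
elim: w F F' => [//|z w IHw] F F' eqf eqF /=.
rewrite eqf ?mem_head // eqF //; congr (_ - _).
apply: IHw => [x xw | v sv]; first by rewrite eqf // inE xw orbT.
by apply: eqF; rewrite /= sv.
Qed.

Lemma contractZ (R : comPzRingType) (T : Type) (f : T -> R) c F w :
  contract f (fun v => c * F v) w = c * contract f F w.
Proof.
elim: w F => [|z w IHw] F /=; first by rewrite mulr0.
by rewrite (IHw (fun v => F (z :: v))); ring.
Qed.

Lemma contractB (R : comPzRingType) (T : Type) (f : T -> R) F G w :
  contract f (fun v => F v - G v) w = contract f F w - contract f G w.
Proof.
elim: w F G => [|z w IHw] F G /=; first by rewrite subrr.
by rewrite (IHw (fun v => F (z :: v)) (fun v => G (z :: v))); ring.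
Qed.

Lemma contract0 (R : comPzRingType) (T : Type) (f : T -> R) F w :
  F =1 (fun=> 0) -> contract f F w = 0.
Proof.
elim: w F => [//|z w IHw] F F0 /=.
by rewrite F0 mulr0 IHw ?subr0 // => v; rewrite F0.
Qed.

(** The two ways of removing two letters differ by one transposition. *)
Lemma contract_anticomm (R : comPzRingType) (T : Type) (f g : T -> R) F w :
  contract f (contract g F) w = - contract g (contract f F) w.
Proof.
elim: w F => [|z w IHw] F /=; first by rewrite oppr0.
by rewrite !contractB !contractZ (IHw (fun v => F (z :: v))); ring.
Qed.

Lemma contract_sqr0 (R : comPzRingType) (T : Type) (f : T -> R) F w :
  contract f (contract f F) w = 0.
Proof.
elim: w F => [//|z w IHw] F /=.
by rewrite contractB contractZ (IHw (fun v => F (z :: v))); ring.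
Qed.

(** Removals from two separate words do not interact, so no sign appears. *)
Lemma contract_fubini (R : comPzRingType) (S T : Type) (g : S -> T -> R)
    F G u v :
  contract (fun a => contract (g a) G v) F u =
  contract (fun b => contract (g^~ b) F u) G v.
Proof.
elim: v G => [|b v IHv] G /=.
  by elim: u F => [//|a u IHu] F /=; rewrite (IHu (fun v => F (a :: v))); ring.
rewrite -(IHv (fun v' => G (b :: v'))) => {IHv}.
elim: u F => [|a u IHu] F /=; first by ring.
by rewrite (IHu (fun v => F (a :: v))); ring.
Qed.

Lemma contractNl (R : comPzRingType) (T : Type) (f : T -> R) F w :
  contract (fun z => - f z) F w = - contract f F w.
Proof.
elim: w F => [|z w IHw] F /=; first by rewrite oppr0.
by rewrite (IHw (fun v => F (z :: v))); ring.
Qed.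

Lemma contract_vanish (R : comPzRingType) (T : eqType) (f : T -> R) F w :
  {in w, f =1 (fun=> 0)} -> contract f F w = 0.
Proof.
elim: w F => [//|z w IHw] F f0 /=.
rewrite f0 ?mem_head // IHw ?mul0r ?subr0 // => x xw.
by rewrite f0 // inE xw orbT.
Qed.

Lemma contract_catl (R : comPzRingType) (T : eqType) (f : T -> R) F u w :
  {in w, f =1 (fun=> 0)} ->
  contract f F (u ++ w) = contract f (fun v => F (v ++ w)) u.
Proof.
move=> f0; elim: u F => [|z u IHu] F /=; first exact: contract_vanish.
by rewrite (IHu (fun v => F (z :: v))).
Qed.

Lemma contract_single (R : comPzRingType) (T : eqType) (f : T -> R) F u y w :
  {in u ++ w, f =1 (fun=> 0)} ->
  contract f F (u ++ y :: w) = (-1) ^+ size u * (f y * F (u ++ w)).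
Proof.
elim: u F => [|z u IHu] F f0 /=.
  by rewrite contract_vanish // mul1r subr0.
rewrite f0 ?mem_head // (IHu (fun v => F (z :: v))) => [|x xuw].
  by rewrite exprS; ring.
by rewrite f0 // inE xuw orbT.
Qed.

Lemma contractN (R : comPzRingType) (T : Type) (f : T -> R) F w :
  contract f (fun v => - F v) w = - contract f F w.
Proof.
elim: w F => [|z w IHw] F /=; first by rewrite oppr0.
by rewrite (IHw (fun v => F (z :: v))); ring.
Qed.

(** The terms removing one of a and b are exchanged with a change of sign,
    because these two letters sit at adjacent positions; in all other terms
    a and b are still adjacent and the hypothesis on F applies. *)
Lemma contract_swap (R : comPzRingType) (T : eqType) (f : T -> R) F :
  (forall u a b v, F (u ++ a :: b :: v) = - F (u ++ b :: a :: v)) ->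
  forall u a b v, contract f F (u ++ a :: b :: v) =
                  - contract f F (u ++ b :: a :: v).
Proof.
move=> FN u; elim: u F FN => [|z u IHu] F FN a b v /=.
  rewrite [X in f a * _ - (_ - X)](@eq_contract _ _ _ f _
    (fun v' => - F [:: b, a & v'])) ?contractN //; first by ring.
  by move=> v' _; exact: (FN [::]).
rewrite (FN u) (IHu (fun v' => F (z :: v'))) ?mulrN ?opprD // => u' a' b' v'.
exact: (FN (z :: u')).
Qed.

Lemma contract_repeat (R : comPzRingType) (T : eqType) (f : T -> R) F :
  (forall u a v, F (u ++ a :: a :: v) = 0) ->
  forall u a v, contract f F (u ++ a :: a :: v) = 0.
Proof.
move=> F0 u; elim: u F F0 => [|z u IHu] F F0 a v /=.
  rewrite (@contract0 _ _ _ (fun v' => F [:: a, a & v'])); first by ring.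
  by move=> v'; exact: (F0 [::]).
rewrite (F0 u) (IHu (fun v' => F (z :: v'))) ?mulr0 ?subr0 // => u' a' v'.
exact: (F0 (z :: u')).
Qed.

(** * Pfaffians of words *)

(** First row expansion removes two letters, the first one and one chosen by
    [contract], so that the recursion is not structural on the word; n bounds
    its depth.  Identities that preserve the length hold for every n and every
    word, hence are easier to prove for [pf_fuel] than for [pf]. *)
Fixpoint pf_fuel (R : comPzRingType) (T : Type) (g : T -> T -> R) (n : nat)
    (w : seq T) {struct n} : R :=
  match w, n with
  | [::], _ => 1
  | x :: v, n'.+1 => contract (g x) (pf_fuel g n') v
  | _ :: _, 0 => 0
  end.

Definition pf (R : comPzRingType) (T : Type) (g : T -> T -> R) (w : seq T) :=
  pf_fuel g (size w) w.

Lemma pf_fuelE (R : comPzRingType) (T : eqType) (g : T -> T -> R) n w :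
  (size w <= n)%N -> pf_fuel g n w = pf g w.
Proof.
rewrite /pf; have [k] := ubnP (size w); elim: k n w => // k IHk [|n] [|x w] //=.
rewrite !ltnS => wk wn; apply: eq_contract => // v vw.
have vk : (size v < k)%N by rewrite vw ltnW.
by rewrite (IHk n) ?(IHk (size w)) //; [rewrite -vw | rewrite ltnW // vw].
Qed.

Lemma pf_cons (R : comPzRingType) (T : eqType) (g : T -> T -> R) x w :
  pf g (x :: w) = contract (g x) (pf g) w.
Proof.
rewrite {1}/pf /=; apply: eq_contract => // v vw.
by rewrite pf_fuelE // -vw.
Qed.

Definition alternating (R : comPzRingType) (T : Type) (g : T -> T -> R) :=
  (forall a b, g b a = - g a b) /\ (forall a, g a a = 0).

(** At the head of the word, expanding twice turns the claim into the
    antisymmetry of g and the anticommutation of contractions. *)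
Lemma pf_swap (R : comPzRingType) (T : eqType) (g : T -> T -> R) u a b v :
  alternating g -> pf g (u ++ a :: b :: v) = - pf g (u ++ b :: a :: v).
Proof.
case=> gN _; rewrite /pf !size_cat /=; move: (size u + _)%N => n.
elim: n u a b v => [|n IHn] [|z u] a b v /=; rewrite ?oppr0 //.
  case: n IHn => [|n] _ /=.
    by rewrite !contract0 // (gN b a) !subr0 mulNr.
  by rewrite (gN b a) contract_anticomm; ring.
by apply: contract_swap => u' a' b' v'; exact: IHn.
Qed.

Lemma pf_repeat (R : comPzRingType) (T : eqType) (g : T -> T -> R) u a v :
  alternating g -> pf g (u ++ a :: a :: v) = 0.
Proof.
case=> gN g0; rewrite /pf size_cat /=; move: (size u + _)%N => n.
elim: n u a v => [|n IHn] [|z u] a v //=.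
  rewrite g0 mul0r sub0r; apply/eqP; rewrite oppr_eq0; apply/eqP.
  by case: n IHn => [|n] _ /=; [rewrite contract0 | rewrite contract_sqr0].
by apply: contract_repeat => u' a' v'; exact: IHn.
Qed.

Lemma pf_move (R : comPzRingType) (T : eqType) (g : T -> T -> R) u x v :
  alternating g -> pf g (u ++ x :: v) = (-1) ^+ size u * pf g (x :: u ++ v).
Proof.
move=> galt; elim/last_ind: u v => [|u z IHu] v; first by rewrite mul1r.
rewrite cat_rcons pf_swap // IHu size_rcons cat_rcons exprS; ring.
Qed.

Lemma pf_mem (R : comPzRingType) (T : eqType) (g : T -> T -> R) x w :
  alternating g -> x \in w -> pf g (x :: w) = 0.
Proof.
move=> galt /splitPr[u v]; have := pf_move u x (x :: v) galt.
by rewrite pf_repeat // => /esym/(canRL (signrMK _)) ->; rewrite mulr0.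
Qed.

(** Expanding Pf(a v) along a on the left, and recognizing on the right the
    expansion of Pf(b u) along b, both sides become the same double
    contraction of u and v by g. *)
Lemma pf_plucker (R : comPzRingType) (T : eqType) (g : T -> T -> R) u v :
  alternating g ->
  contract (fun a => pf g (a :: v)) (pf g) u =
  - contract (fun b => pf g (b :: u)) (pf g) v.
Proof.
case=> gN _; rewrite -contractNl.
rewrite (eq_contract _ (f' := fun a => contract (g a) (pf g) v) (F' := pf g)) //.
  (* After the exchange, the inner contraction is by g(_, b) = - g(b, _). *)
  rewrite contract_fubini; apply: eq_contract => // b _.
  rewrite pf_cons -contractNl; apply: eq_contract => // a _.
by move=> a _; rewrite pf_cons.
Qed.

(** The Plücker relation for x W and X W: a letter of W brought in front of a
    word that contains W gives zero, so that only x survives on the left and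
    only the letters of X on the right. *)
Lemma pf_wick_step (R : comPzRingType) (T : eqType) (g : T -> T -> R) x X W :
  alternating g ->
  pf g W * pf g (x :: X ++ W) =
  contract (fun b => pf g [:: x, b & W]) (fun v => pf g (v ++ W)) X.
Proof.
move=> galt; have := pf_plucker (x :: W) (X ++ W) galt; rewrite /=.
rewrite contract_vanish => [|a aW]; last first.
  by rewrite pf_mem // mem_cat aW orbT.
rewrite subr0 mulrC => ->; rewrite contract_catl => [|b bW]; last first.
  by rewrite pf_mem // inE bW orbT.
rewrite -contractNl; apply: eq_contract => // b _.
by rewrite (pf_swap [::] _ _ _ galt) opprK.
Qed.

(** By [pf_wick_step], Pf(X W) satisfies up to a factor Pf(W) the first row
    expansion that defines the left-hand side; each pair of letters of X
    beyond the first contributes one such factor. *)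
Lemma pf_wick (R : comPzRingType) (T : eqType) (g : T -> T -> R) W X h :
  alternating g -> size X = h.+1.*2 ->
  pf (fun a b => pf g [:: a, b & W]) X = pf g (X ++ W) * pf g W ^+ h.
Proof.
move=> galt; elim: h X => [|h IHh] [|x X] //=.
  case: X => [|y [|z X]] //= _; rewrite pf_cons /= /pf /=; ring.
move=> [sX]; rewrite pf_cons.
rewrite (eq_contract _ (f' := fun b => pf g [:: x, b & W])
  (F' := fun v => pf g W ^+ h * pf g (v ++ W))) //.
  by rewrite contractZ -pf_wick_step // exprS; ring.
by move=> v; rewrite sX => -[/IHh ->]; rewrite mulrC.
Qed.

(** Bring x to the front, expand along it, and only y contributes; the
    letters of u are crossed twice, hence the sign sees v alone. *)
Lemma pf_partner (R : comPzRingType) (T : eqType) (g : T -> T -> R) u x v y w :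
  alternating g -> {in u ++ v ++ w, g x =1 (fun=> 0)} ->
  pf g (u ++ x :: v ++ y :: w) = (-1) ^+ size v * g x y * pf g (u ++ v ++ w).
Proof.
move=> galt g0; rewrite pf_move // pf_cons !catA contract_single -?catA //.
by rewrite size_cat exprD -!mulrA signrMK.
Qed.

Lemma pf_map (R : comPzRingType) (S T : eqType) (g : T -> T -> R) (h : S -> T) w :
  pf g (map h w) = pf (fun a b => g (h a) (h b)) w.
Proof.
have contract_map f F (v : seq S) :
    contract f F (map h v) = contract (f \o h) (F \o map h) v.
  by elim: v F => [//|z v IHv] F /=; rewrite (IHv (fun v => F (h z :: v))).
have [k] := ubnP (size w); elim: k w => // k IHk [//|x w] /= wk.
rewrite !pf_cons contract_map; apply: eq_contract => // v vw /=.
by rewrite IHk // vw ltnW.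
Qed.

(** * First row expansion of the Pfaffian of a matrix *)
Lemma pf_permP (n : nat) (s : 'S_n) :
  reflect (forall i j : 'I_n, ~~ odd i -> j = i.+1 :> nat \/ j = i.+2 :> nat ->
             (s i < s j)%N)
          (pf_perm s).
Proof.
apply: (iffP forallP) => [H i j ev ij | H i].
  have /forallP/(_ j)/implyP := H i; apply; rewrite ev /=.
  by case: ij => ->; rewrite eqxx ?orbT.
apply/forallP => j; apply/implyP => /andP[ev ij]; apply: H => //.
by case/orP: ij => /eqP; [left | right].
Qed.

(** The values at even positions increase and each odd position has a larger
    value than its predecessor, so 0 is taken at the first position. *)
Lemma pf_perm0 (n : nat) (s : 'S_n.+1) : pf_perm s -> s ord0 = ord0.
Proof.
move=> /pf_permP sP.
have min0 (i : nat) (lin : (i < n.+1)%N) : (s ord0 <= s (Ordinal lin))%N.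
  have [k] := ubnP i; elim: k i lin => // k IHk [|[|i]] lin ik.
  - by rewrite leq_eqVlt; apply/orP; left; apply/eqP; do 2!f_equal; apply: val_inj.
  - by apply/ltnW/sP => //=; left.
  case: (boolP (odd i)) => ev.
    have li1 : (i.+1 < n.+1)%N by apply: ltnW.
    apply: leq_trans (IHk i.+1 li1 _) _; first exact: ik.
    by apply/ltnW/sP; [rewrite /= ev | left].
  have li : (i < n.+1)%N by apply/ltnW/ltnW.
  apply: leq_trans (IHk i li _) _; first exact: ltnW.
  by apply/ltnW/sP; [ | right].
apply: val_inj; apply/eqP; rewrite /= -leqn0.
case Es0: ((s^-1)%g ord0) => [i lin].
by have := min0 i lin; rewrite -Es0 permKV.
Qed.

(** The permutation which pairs 0 with k + 1 and then follows s on the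
    remaining indices; every element of [pf_perm] arises in this way from
    exactly one pair, which is the combinatorial content of the expansion. *)
Definition pf_perm_cons (n : nat) (p : 'I_n.+1 * 'S_n) : 'S_n.+2 :=
  lift_perm ord0 ord0 (lift_perm ord0 p.1 p.2).

Lemma pf_perm_cons_inj (n : nat) : injective (@pf_perm_cons n).
Proof.
move=> [k s] [k' s'] /permP eqL.
have := eqL (lift ord0 ord0).
rewrite /pf_perm_cons /= !lift_perm_lift !lift_perm_id => /lift_inj Dk.
rewrite -{}Dk in eqL *; congr (_, _); apply/permP => i.
have := eqL (lift ord0 (lift ord0 i)).
by rewrite /pf_perm_cons /= !lift_perm_lift => /lift_inj/lift_inj.
Qed.

Lemma ltn_lift (n : nat) (k : 'I_n.+1) (i j : 'I_n) :
  (lift k i < lift k j)%N = (i < j)%N.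
Proof. by rewrite !ltnNge leq_bump2. Qed.

(** The first position carries 0, so the conditions involving it are free; the
    others are those on s, because the two lifts are increasing. *)
Lemma pf_perm_consE (n : nat) (k : 'I_n.+1) (s : 'S_n) :
  pf_perm (pf_perm_cons (k, s)) = pf_perm s.
Proof.
have consE i : pf_perm_cons (k, s) (lift ord0 (lift ord0 i)) =
               lift ord0 (lift k (s i)).
  by rewrite !lift_perm_lift.
apply/pf_permP/pf_permP => sP i j ev ij.
  have := sP (lift ord0 (lift ord0 i)) (lift ord0 (lift ord0 j)).
  rewrite !consE !ltn_lift; apply; first by rewrite !lift0 /= negbK.
  by rewrite !lift0; case: ij => ->; [left | right].
move: ev ij; case: (unliftP ord0 i) => [i1 ->|->]; last first.
  case: (unliftP ord0 j) => [j1 ->|-> _ []] // _ _.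
  by rewrite lift_perm_id lift_perm_lift lift0.
case: (unliftP ord0 i1) => [i2 ->|-> //].
case: (unliftP ord0 j) => [j1 ->|-> _ []] //.
case: (unliftP ord0 j1) => [j2 ->|-> _ []] //.
rewrite !consE !ltn_lift !lift0 /= negbK => ev ij; apply: sP => //.
by case: ij => -[]; [left | right].
Qed.

Lemma pf_perm_image (n : nat) (s : 'S_n.+2) :
  pf_perm s = (s \in [set pf_perm_cons p | p in [pred p | pf_perm p.2]]).
Proof.
apply/idP/imsetP => [sP | [[k t] tP ->]]; last by rewrite pf_perm_consE.
have s0 := pf_perm0 sP.
case: (unliftP ord0 (s (lift ord0 ord0))) => [k sk|]; last first.
  by rewrite -[RHS]s0 => /perm_inj.
have sll i : exists i', s (lift ord0 (lift ord0 i)) = lift ord0 (lift k i').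
  case: (unliftP ord0 (s (lift ord0 (lift ord0 i)))) => [i1 si|]; last first.
    by rewrite -[RHS]s0 => /perm_inj.
  case: (unliftP k i1) si => [i2 -> ->|->]; first by exists i2.
  by rewrite -sk => /perm_inj/lift_inj.
case: (fin_all_exists sll) => t tE.
have t_inj : injective t.
  move=> i j tij; have: s (lift ord0 (lift ord0 i)) = s (lift ord0 (lift ord0 j)).
    by rewrite !tE tij.
  by move/perm_inj/lift_inj/lift_inj.
have Ds : s = pf_perm_cons (k, perm t_inj).
  apply/permP => i; case: (unliftP ord0 i) => [i1 ->|->]; last first.
    by rewrite lift_perm_id.
  case: (unliftP ord0 i1) => [i2 ->|->]; last first.
    by rewrite lift_perm_lift lift_perm_id.
  by rewrite tE !lift_perm_lift permE.
by exists (k, perm t_inj); rewrite // inE /= -(pf_perm_consE k) -Ds.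
Qed.

Lemma prod_pairs_recl (R : comPzRingType) (n : nat)
    (F : 'I_n.+2 -> 'I_n.+2 -> R) :
  \prod_(p : 'I_n.+2 * 'I_n.+2 | ~~ odd p.1 && (p.2 == p.1.+1 :> nat))
     F p.1 p.2 =
  F ord0 (lift ord0 ord0) *
  \prod_(p : 'I_n * 'I_n | ~~ odd p.1 && (p.2 == p.1.+1 :> nat))
     F (lift ord0 (lift ord0 p.1)) (lift ord0 (lift ord0 p.2)).
Proof.
have pairs m (G : 'I_m -> 'I_m -> R) :
    \prod_(p : 'I_m * 'I_m | ~~ odd p.1 && (p.2 == p.1.+1 :> nat)) G p.1 p.2 =
    \prod_(i < m) \prod_(j < m)
       if ~~ odd i && (j == i.+1 :> nat) then G i j else 1.
  by rewrite big_mkcond pair_big.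
pose ll (i : 'I_n) : 'I_n.+2 := lift ord0 (lift ord0 i).
rewrite pairs (pairs n (fun i j => F (ll i) (ll j))).
rewrite 2!big_ord_recl !(big_ord_recl, mul1r) /= big1 // mulr1.
rewrite mul1r; congr (_ * _); apply: eq_bigr => i _.
by rewrite !big_ord_recl /= andbF !mul1r; apply: eq_bigr => j _; rewrite negbK.
Qed.

(** The lifted permutation has the sign of s times (-1)^k, and its first pair
    contributes the entry of A in row 0. *)
Lemma Pf_expand (R : comPzRingType) (n : nat) (A : 'M[R]_n.+2) :
  Pf A = \sum_(k < n.+1) (-1) ^+ k * (A ord0 (lift ord0 k) *
           Pf (mxsub (lift ord0 \o lift k) (lift ord0 \o lift k) A)).
Proof.
rewrite /Pf; under eq_bigl do rewrite pf_perm_image.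
rewrite big_imset /=; last by move=> ? ? _ _; apply: pf_perm_cons_inj.
under [RHS]eq_bigr do rewrite mulrA big_distrr.
rewrite [RHS]pair_big /=; apply: eq_big => [[k s]|[k s] _] //=.
rewrite !odd_lift_perm /= signr_addb signr_odd -!mulrA.
congr (_ * _); rewrite mulrCA; congr (_ * _).
rewrite (prod_pairs_recl
  (fun i j => A (pf_perm_cons (k, s) i) (pf_perm_cons (k, s) j))).
rewrite lift_perm_lift !lift_perm_id; congr (_ * _); apply: eq_bigr => p _.
by rewrite !mxE !lift_perm_lift.
Qed.

Lemma contract_enum (R : comPzRingType) (T : Type) (f : T -> R) F n
    (h : 'I_n.+1 -> T) :
  contract f F [seq h i | i <- enum 'I_n.+1] =
  \sum_(k < n.+1) (-1) ^+ k * (f (h k) * F [seq h (lift k i) | i <- enum 'I_n]).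
Proof.
elim: n h F => [|n IHn] h F; rewrite enum_ordSl big_ord_recl /= mul1r -map_comp.
  rewrite big_ord0 addr0.
  by case: (enum 'I_0) (size_enum_ord 0) => //= _; rewrite subr0.
congr (_ + _); rewrite (IHn (h \o lift ord0) (fun v => F (h ord0 :: v))).
rewrite -sumrN; apply: eq_bigr => k _.
rewrite /bump leq0n add1n exprS mulN1r mulNr enum_ordSl /= -map_comp /=.
congr (- (_ * (_ * F (_ :: _)))); first by congr h; apply: val_inj.
by apply: eq_map => i /=; congr h; apply: val_inj; rewrite /= bumpS.
Qed.

(** Only entries above the diagonal are compared, since a permutation in
    [pf_perm] uses no others.  Parity matters: the defining sum of a matrix of
    odd size need not vanish, whereas the Pfaffian of an odd word does. *)
Lemma Pf_word (R : comPzRingType) (T : eqType) (g : T -> T -> R) n (A : 'M[R]_n)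
    (h : 'I_n -> T) :
  ~~ odd n -> (forall i j : 'I_n, (i < j)%N -> A i j = g (h i) (h j)) ->
  Pf A = pf g [seq h i | i <- enum 'I_n].
Proof.
have [m] := ubnP n; elim: m n A h => // m IHm [|[|n]] A h //= nm ev eqA.
  case: (enum 'I_0) (size_enum_ord 0) => //= _; rewrite /Pf (big_pred1 1%g).
    by rewrite big1 ?odd_perm1 ?mulr1 // => -[[]].
  move=> s; apply/pf_permP/eqP => [_ | _ []] //.
  by apply/permP => -[].
rewrite Pf_expand enum_ordSl /= pf_cons -map_comp.
rewrite (contract_enum _ _ (h \o lift ord0)); apply: eq_bigr => k _.
rewrite eqA //= (IHm _ _ (h \o lift ord0 \o lift k)) //.
- by rewrite -ltnS; apply: ltnW.
- by rewrite negbK in ev.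
- by move=> i j ij; rewrite mxE eqA // (ltn_lift ord0) ltn_lift.
Qed.

Lemma Pf_submx_seq (R : comPzRingType) (N : nat) (Y : 'M[R]_N) (s : seq 'I_N) :
  ~~ odd (size s) -> Pf (submx_seq Y s) = pf (fun i j => Y i j) s.
Proof.
move=> ev; rewrite (Pf_word (g := fun i j => Y i j) (h := tnth (in_tuple s))) //.
  by rewrite map_tnth_enum.
by move=> i j _; rewrite mxE.
Qed.

(** * Deleting letters with dual letters *)

(** Ordinary letters carry a tag.  The letter [inr s] pairs only with ordinary
    letters tagged s: tags distinguish the positions of J even when J has
    repeated entries, and letters of I and K get a tag that is not a position
    of J.  The value (-1)^s compensates for the s letters of J that lie between
    the dual letter and its partner in [pf_star]. *)
Definition star_form (R : comPzRingType) (S : Type) (g : S -> S -> R)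
    (a b : S * nat + nat) : R :=
  match a, b with
  | inl p, inl q => g p.1 q.1
  | inr s, inl q => if q.2 == s then (-1) ^+ s else 0
  | inl p, inr s => if p.2 == s then - (-1) ^+ s else 0
  | inr _, inr _ => 0
  end.

Lemma star_form_alt (R : comPzRingType) (S : Type) (g : S -> S -> R) :
  alternating g -> alternating (star_form g).
Proof.
case=> gN g0; split=> [[p|s] [q|t]|[p|s]] //=; rewrite ?oppr0 //.
  by case: ifP; rewrite ?opprK ?oppr0.
by case: ifP; rewrite ?opprK ?oppr0.
Qed.

(** The dual letters are eliminated from the last one to the first.  The last
    dual letter is next to J, and its partner has position s, so s letters lie
    in between: the sign of [pf_partner] is cancelled by the value of the form.
    What precedes that partner in J is intact, which keeps positions and tags
    in agreement for the next step; what follows it joins w. *)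
Lemma pf_star (R : comPzRingType) (S : eqType) (g : S -> S -> R) (P : pred nat)
    (J : seq S) (u w : seq (S * nat)) :
  alternating g -> {in u ++ w, forall p, (size J <= p.2)%N} ->
  pf (star_form g) (map inl u ++ map inr [seq k <- iota 0 (size J) | P k] ++
                    map inl (zip J (iota 0 (size J))) ++ map inl w) =
  pf g (map fst u ++ mask [seq ~~ P k | k <- iota 0 (size J)] J ++ map fst w).
Proof.
move=> galt; elim/last_ind: J u w => [|J x IHJ] u w tags.
  by rewrite /= -!map_cat pf_map pf_map.
have tagsJ p : p \in u ++ w -> (size J < p.2)%N.
  by move/tags; rewrite size_rcons.
have iotaS k : iota 0 k.+1 = rcons (iota 0 k) k by rewrite -addn1 iotaD cats1.
rewrite size_rcons iotaS zip_rcons ?size_iota // filter_rcons.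
rewrite !map_rcons mask_rcons ?size_map ?size_iota //.
case: ifP => /= _; last first.
  rewrite (cat_rcons _ (map inl _)) -[_ :: map inl w]/(map inl ((x, size J) :: w)).
  rewrite IHJ /= ?cats1 ?cat_rcons // => p.
  rewrite mem_cat inE orbCA -mem_cat => /predU1P[->//|/tagsJ].
  exact: ltnW.
rewrite cats0 -IHJ; last by move=> p /tagsJ /ltnW.
rewrite map_rcons !cat_rcons catA pf_partner ?catA //; last first.
- move=> c; rewrite !mem_cat -!orbA => /or4P[] /mapP[p pin ->] //=.
  + by case: eqP (tagsJ p) => // <-; rewrite mem_cat pin ltnn => /(_ isT).
  + have := map_f snd pin; rewrite -/(unzip2 _) unzip2_zip ?size_iota //.
    by rewrite mem_iota add0n /= ltn_neqAle => /andP[/negPf->].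
  + by case: eqP (tagsJ p) => // <-; rewrite mem_cat pin orbT ltnn => /(_ isT).
- exact: star_form_alt.
by rewrite size_map size_zip size_iota minnn /= eqxx -expr2 sqrr_sign mul1r -!catA.
Qed.

(** Passes from the sorted lists of positions given to [del_pos] to the
    predicates in [pf_star], which are better suited to an induction on J. *)
Lemma filter_mem_iota (B : seq nat) m :
  sorted ltn B -> all (ltn^~ m) B -> [seq k <- iota 0 m | k \in B] = B.
Proof.
move=> sB ltB; apply: (irr_sorted_eq ltn_trans ltnn) => //.
  by apply: sorted_filter; [exact: ltn_trans | exact: iota_ltn_sorted].
move=> k; rewrite mem_filter mem_iota add0n /=.
by case: (boolP (k \in B)) => //= /(allP ltB).
Qed.

Lemma size_del_pos (T : Type) (B : seq nat) (J : seq T) :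
  sorted ltn B -> all (ltn^~ (size J)) B ->
  (size B + size (del_pos B J))%N = size J.
Proof.
move=> sB ltB; rewrite -{1}(filter_mem_iota sB ltB) size_filter.
rewrite size_mask ?size_map ?size_iota // count_map.
by rewrite -[RHS](size_iota 0) -(count_predC (mem B)).
Qed.

Lemma del_pos_nil (T : Type) (J : seq T) : del_pos [::] J = J.
Proof.
rewrite /del_pos -[RHS](@mask_true _ _ (size J)) //; congr mask.
by elim: (size J) 0%N => //= k IHk i; rewrite IHk.
Qed.

Lemma del_pos_iota (T : Type) (J : seq T) : del_pos (iota 0 (size J)) J = [::].
Proof.
rewrite /del_pos -[RHS](mask_false J (size J)); congr mask.
apply: (@eq_from_nth _ true); rewrite size_map size_iota ?size_nseq // => k kJ.
by rewrite (nth_map 0%N) ?size_iota // nth_nseq kJ mem_nth ?size_iota.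
Qed.

(** * The theorem *)
Definition star_base (S : Type) (J K : seq S) : seq (S * nat + nat) :=
  map inl (zip J (iota 0 (size J)) ++ [seq (x, size J) | x <- K]).

(** With 0, 1 or 2 positions in B and as many letters in u as needed to make a
    pair, this covers the three kinds of entries of [Ytilde]; with all positions
    of J in B, it covers the collapse of I J K to I K. *)
Lemma Pf_del_pos (R : comPzRingType) (N : nat) (Y : 'M[R]_N)
    (u J K : seq 'I_N) (B : seq nat) :
  skew_symmetric Y -> sorted ltn B -> all (ltn^~ (size J)) B ->
  ~~ odd (size u + size B + size J + size K) ->
  pf (star_form (fun i j => Y i j))
     ([seq inl (x, size J) | x <- u] ++ map inr B ++ star_base J K) =
  Pf (submx_seq Y (u ++ del_pos B J ++ K)).
Proof.
move=> hY sB ltB ev; rewrite Pf_submx_seq; last first.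
  move: ev; rewrite -{1}(size_del_pos sB ltB) !size_cat !oddD.
  by case: (odd (size B)); case: (odd (size u)); case: (odd _); case: (odd _).
have fst_tag (w : seq 'I_N) : map fst [seq (x, size J) | x <- w] = w.
  by rewrite -map_comp map_id.
rewrite -[in RHS](fst_tag u) -[in RHS](fst_tag K) -pf_star //; last first.
  by move=> p; rewrite -map_cat => /mapP[x _ ->].
by rewrite filter_mem_iota // /star_base map_cat -!map_comp.
Qed.

(** The indices of [Ytilde] become the entries of I followed by the dual
    letters of J. *)
Definition star_letter (N l m : nat) (I : l.-tuple 'I_N) (c : 'I_(l + m)) :
    'I_N * nat + nat :=
  match split c with
  | inl a => inl (tnth I a, m)
  | inr b => inr (val b)
  end.

Lemma star_letters (N l m : nat) (I : l.-tuple 'I_N) :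
  [seq star_letter I c | c <- enum 'I_(l + m)] =
  [seq inl (x, m) | x <- I] ++ map inr (iota 0 m).
Proof.
have enumD : enum 'I_(l + m) =
    map (lshift m) (enum 'I_l) ++ map (@rshift l m) (enum 'I_m).
  apply: (inj_map val_inj); rewrite val_enum_ord map_cat iotaD.
  rewrite -(map_comp _ (lshift m)) -(map_comp _ (@rshift l m)) add0n.
  congr (_ ++ _); first by rewrite -val_enum_ord; apply: eq_map.
  by rewrite -[in LHS](addn0 l) iotaDl -val_enum_ord -map_comp; apply: eq_map.
rewrite enumD map_cat -(map_comp _ (lshift m)) -(map_comp _ (@rshift l m)).
rewrite -[in RHS](map_tnth_enum I) -map_comp.
rewrite -val_enum_ord -map_comp; congr (_ ++ _); apply: eq_map => i /=.
  by rewrite /star_letter (unsplitK (inl i)).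
by rewrite /star_letter (unsplitK (inr i)).
Qed.

Lemma Pf_Ytilde (R : comPzRingType) (N : nat) (Y : 'M[R]_N) (l m n : nat)
    (I : l.-tuple 'I_N) (J : m.-tuple 'I_N) (K : n.-tuple 'I_N) :
  skew_symmetric Y -> odd l = odd m -> odd m = odd n ->
  Pf (Ytilde Y I J K) =
  pf (fun a b => pf (star_form (fun i j => Y i j)) [:: a, b & star_base J K])
     ([seq inl (x, m) | x <- I] ++ map inr (iota 0 m)).
Proof.
move=> hY hlm hmn; rewrite -star_letters; apply: Pf_word.
  by rewrite oddD hlm addbb.
have entry (u : seq 'I_N) B := @Pf_del_pos R N Y u J K B hY.
rewrite !size_tuple in entry.
move=> i j ij; rewrite /Ytilde /star_letter /=.
case: (split_ordP i) ij => a -> ; case: (split_ordP j) => b -> /= ij.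
- rewrite block_mxEul mxE ij -[in LHS](del_pos_nil J).
  by rewrite -(entry [:: _; _]) // !oddD hmn addbb.
- rewrite block_mxEur mxE -(entry [:: _]) //= ?ltn_ord //.
  by rewrite !oddD hmn addbb.
- by rewrite ltnNge ltnW // in ij; rewrite /= (leq_trans (ltn_ord b)) // leq_addr.
- rewrite ltn_add2l in ij.
  rewrite block_mxEdr mxE ij -(entry [::]) //= ?ij ?ltn_ord //.
  by rewrite !oddD hmn addbb.
Qed.

Theorem theorem1p4 (R : comPzRingType) (N : nat) (Y : 'M[R]_N)
    (hY : skew_symmetric Y) (l m n : nat)
    (hlm : odd l = odd m) (hmn : odd m = odd n)
    (I : l.-tuple 'I_N) (J : m.-tuple 'I_N) (K : n.-tuple 'I_N) :
  ((0 < l + m)%N ->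
     Pf (Ytilde Y I J K) =
       Pf (submx_seq Y (I ++ K)) *
       Pf (submx_seq Y (J ++ K)) ^+ ((l + m)./2 - 1)) /\
  ((l + m = 0)%N ->
     forall u : R, Pf (submx_seq Y (J ++ K)) * u = 1 ->
     Pf (Ytilde Y I J K) = Pf (submx_seq Y (I ++ K)) * u).
Proof.
rewrite Pf_Ytilde //; split=> [lm_gt0 | /eqP].
  have evlm : ~~ odd (l + m) by rewrite oddD hlm addbb.
  have Dlm : (l + m)%N = ((l + m)./2 - 1).+1.*2.
    rewrite subn1 prednK ?even_halfK // half_gt0.
    by case: (l + m)%N lm_gt0 evlm => [|[]].
  have size_letters : size ([seq inl (x, m) | x <- I] ++ map inr (iota 0 m)) =
      ((l + m)./2 - 1).+1.*2.
    by rewrite -Dlm size_cat !size_map size_tuple size_iota.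
  rewrite (pf_wick _ (star_form_alt hY) size_letters); congr (_ * _ ^+ _).
    have := del_pos_iota J; rewrite size_tuple -catA => delJ.
    have := @Pf_del_pos R N Y I J K (iota 0 m) hY (iota_ltn_sorted 0 m).
    rewrite delJ !size_tuple; apply.
      by apply/allP => k; rewrite mem_iota.
    by rewrite !oddD hlm hmn !addbb.
  rewrite -[in RHS](del_pos_nil J) -(@Pf_del_pos R N Y [::]) //=.
  by rewrite addn0 !size_tuple oddD hmn addbb.
rewrite addn_eq0 => /andP[/eqP l0 /eqP m0] u pu.
subst l m; rewrite (tuple0 I); rewrite (tuple0 J) in pu.
by rewrite [RHS]pu.
Qed.
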